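(* Let $E,A\in\mathbb{R}^{n\times n}$ with $E$ nonsingular. Then $(E,A)$ is admissible if and only if there exist $S,U,B\in\mathbb{R}^{n\times n}$ with $S$ invertible, $U^TU=I_n$, $B$ symmetric positive semidefinite and $\|B\|\le1$, such that $A=S^{-1}UBSE$.
   Context: A pair $(E,A)$ of real $n\times n$ matrices is regular if $\det(\lambda E-A)$ is not identically zero in $\lambda$; its finite eigenvalues are the roots of $\det(zE-A)$. The index of a regular pair is defined via the Weierstrass canonical form $E=W\operatorname{diag}(I_q,N)T$, $A=W\operatorname{diag}(J,I_{n-q})T$ ($N$ nilpotent) as the nilpotency degree of $N$ if $q<n$, and $0$ if $E$ is nonsingular. The pair is stable if all finite eigenvalues lie in the closed unit disk and those on the unit circle are semisimple, and admissible if it is regular, of index at most one, and stable. $\|\cdot\|$ is the spectral norm. *)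

(* Defs.v *)
(* Real numbers are the real elements (Num.real) of an
   arbitrary numerically closed field C (e.g. the complex numbers C = R[i]). *)
From HB Require Import structures.
From mathcomp Require Import all_boot all_order all_algebra.
Set Implicit Arguments. Unset Strict Implicit. Unset Printing Implicit Defensive.
Import Order.TTheory GRing.Theory Num.Theory.
Local Open Scope ring_scope.

Section Defs.
Variable C : numClosedFieldType.

Definition is_realmx (m p : nat) (M : 'M[C]_(m, p)) : Prop :=
  forall i j, M i j \is Num.real.

Definition regular_pencil (n : nat) (E A : 'M[C]_n) : Prop :=
  exists z : C, \det (z *: E - A) != 0.

Definition pencil_poly (n : nat) (E A : 'M[C]_n) : {poly C} :=
  \det ('X *: map_mx polyC E - map_mx polyC A).

Definition finite_eig (n : nat) (E A : 'M[C]_n) (z : C) : Prop :=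
  \det (z *: E - A) = 0.

Definition semisimple_eig (n : nat) (E A : 'M[C]_n) (z : C) : Prop :=
  mup z (pencil_poly E A) = (n - \rank (z *: E - A)%R)%N.

Definition stable_pencil (n : nat) (E A : 'M[C]_n) : Prop :=
  forall z : C, finite_eig E A z ->
    `|z| <= 1 /\ (`|z| = 1 -> semisimple_eig E A z).

(* (W, T, q, J, N) is a (real) Weierstrass canonical form of (E, A):
   E = W diag(I_q, N) T, A = W diag(J, I_(n-q)) T, N nilpotent.
   The block diag(I_q, N) is written pid_mx q + N with N supported on the
   lower-right (n-q)x(n-q) block, and diag(J, I) as J + copid_mx q with J
   supported on the upper-left q x q block. *)
Definition weierstrass_form (n : nat) (E A W T : 'M[C]_n) (q : nat)
    (J N : 'M[C]_n) : Prop :=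
  [/\ is_realmx W, is_realmx T, is_realmx J & is_realmx N]
  /\ (W \in unitmx /\ T \in unitmx)
  /\ (q <= n)%N /\ [/\
      J = pid_mx q *m J *m pid_mx q,
      N = copid_mx q *m N *m copid_mx q,
      (exists k, N ^+ k = 0),
      E = W *m (pid_mx q + N) *m T
    & A = W *m (J + copid_mx q) *m T].

(* index <= k: nilpotency degree of N is <= k if q < n (index 0 if q = n) *)
Definition index_le (n : nat) (E A : 'M[C]_n) (k : nat) : Prop :=
  exists W T q J N, weierstrass_form E A W T q J N /\
    ((q < n)%N -> N ^+ k = 0).

Definition admissible (n : nat) (E A : 'M[C]_n) : Prop :=
  [/\ regular_pencil E A, index_le E A 1 & stable_pencil E A].

Definition vnorm2 (n : nat) (x : 'cV[C]_n) : C := \sum_i `|x i 0| ^+ 2.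

Definition spec_norm_le1 (n : nat) (B : 'M[C]_n) : Prop :=
  forall x : 'cV[C]_n, is_realmx x -> vnorm2 (B *m x) <= vnorm2 x.

Definition sym_psd (n : nat) (B : 'M[C]_n) : Prop :=
  B^T = B /\ forall x : 'cV[C]_n, is_realmx x -> 0 <= (x^T *m B *m x) 0 0.

End Defs.

(* Main.v *)
(* Put M = A E^-1; since E is invertible, regularity and the index condition are
   automatic, and the claim is that M is stable iff it is similar, over the
   reals, to a real contraction, which is then written U B by polar
   decomposition.
   If M is similar to a contraction, Schur-triangularise the latter by a unitary
   matrix: columns have norm at most 1, so a column with a unimodular diagonal
   entry vanishes off the diagonal, which makes that eigenvalue semisimple.
   Conversely, a complex G with G M G^-1 contractive is built by induction on the
   size, splitting off one eigenvalue at a time. Then P = 2 Re (G^* G) is real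
   positive definite with M^T P M <= P, and a real factorisation P = S^T S makes
   S M S^-1 a real contraction. Everything is algebraic (no limits), as the real
   elements of C need not be archimedean. *)
Require Import Defs.
From HB Require Import structures.
From mathcomp Require Import all_boot all_order all_algebra ring.
Set Implicit Arguments. Unset Strict Implicit. Unset Printing Implicit Defensive.
Import Order.TTheory GRing.Theory Num.Theory.
Local Open Scope ring_scope.
Local Open Scope sesquilinear_scope.

(** * Squared Euclidean norm of complex vectors *)

Lemma vnorm2E (C : numClosedFieldType) (n : nat) (x : 'cV[C]_n) :
  vnorm2 x = (x ^t* *m x) 0 0.
Proof. by rewrite mxE; apply: eq_bigr => i _; rewrite !mxE normCK mulrC. Qed.

Lemma vnorm2_ge0 (C : numClosedFieldType) (n : nat) (x : 'cV[C]_n) :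
  0 <= vnorm2 x.
Proof. by apply: sumr_ge0 => i _; rewrite exprn_ge0. Qed.

Lemma vnorm2_gt0 (C : numClosedFieldType) (n : nat) (x : 'cV[C]_n) :
  x != 0 -> 0 < vnorm2 x.
Proof.
rewrite lt0r vnorm2_ge0 andbT; apply: contra.
rewrite psumr_eq0 => [/allP x0|i _]; last exact: exprn_ge0.
apply/eqP/colP => i; have := x0 i (mem_index_enum i).
by rewrite mxE /= sqrf_eq0 normr_eq0 => /eqP.
Qed.

Lemma vnorm2Z (C : numClosedFieldType) (n : nat) (a : C) (x : 'cV[C]_n) :
  vnorm2 (a *: x) = `|a| ^+ 2 * vnorm2 x.
Proof. by rewrite mulr_sumr; apply: eq_bigr => i _; rewrite mxE normrM exprMn. Qed.

Lemma vnorm2_col_mx (C : numClosedFieldType) (m n : nat) (x : 'cV[C]_m)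
    (y : 'cV[C]_n) : vnorm2 (col_mx x y) = vnorm2 x + vnorm2 y.
Proof.
by rewrite /vnorm2 big_split_ord /=; congr (_ + _); apply: eq_bigr => i _;
  rewrite ?col_mxEu ?col_mxEd.
Qed.

Lemma vnorm2_isometry (C : numClosedFieldType) (m n : nat) (P : 'M[C]_(m, n))
    (x : 'cV[C]_n) : P ^t* *m P = 1%:M -> vnorm2 (P *m x) = vnorm2 x.
Proof.
move=> PP; rewrite !vnorm2E trmx_mul map_mxM mulmxA.
by rewrite -(mulmxA _ (P ^t*)) PP mulmx1.
Qed.

(** * Rank and eigenvalue multiplicity of triangular matrices and pencils *)

(** A sum of [delta_mx] terms has rank at most their number. The diagonal matrices of [P] and of its
    complement add up to the identity, which forces equality in both bounds. *)
Lemma rank_diag_mx_bool (F : fieldType) (n : nat) (P : pred 'I_n) :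
  \rank (diag_mx (\row_i (P i)%:R) : 'M[F]_n) = #|P|.
Proof.
have le_rank (Q : pred 'I_n) :
    (\rank (diag_mx (\row_i (Q i)%:R) : 'M[F]_n) <= #|Q|)%N.
  rewrite diag_mx_sum_delta.
  have -> : #|Q| = (\sum_i Q i)%N by rewrite -sum1_card [LHS]big_mkcond.
  elim/big_rec2: _ => [|i k D _ leD]; first by rewrite mxrank0.
  apply: leq_trans (mxrank_add _ _) (leq_add _ leD); rewrite mxE.
  by case: (Q i); rewrite ?scale1r ?mxrank_delta ?scale0r ?mxrank0.
apply/eqP; rewrite eqn_leq le_rank -(leq_add2r #|predC P|) cardC card_ord.
suff le_n : (n <= \rank (diag_mx (\row_i (P i)%:R) : 'M[F]_n)
    + \rank (diag_mx (\row_i (predC P i)%:R) : 'M[F]_n))%N.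
  by rewrite (leq_trans le_n) // leq_add2l le_rank.
  apply: leq_trans (mxrank_add _ _); rewrite -raddfD /=.
  suff -> : \row_i (P i)%:R + \row_i (~~ P i)%:R = const_mx 1 :> 'rV[F]_n.
    by rewrite diag_const_mx mxrank1.
  by apply/rowP => i; rewrite !mxE; case: (P i); rewrite ?addr0 ?add0r.
Qed.

(** Adding ones at the zero diagonal places makes the triangular [N] invertible, and rank is
    subadditive. *)
Lemma trig_rank_ge (F : fieldType) (n : nat) (N : 'M[F]_n) : is_trig_mx N ->
  (n <= \rank N + #|[pred i | N i i == 0%R]|)%N.
Proof.
move=> /is_trig_mxP Ntrig; set P := [pred i | _].
rewrite -(rank_diag_mx_bool F P).
have /mxrank_unit {1}<- : N + diag_mx (\row_i (P i)%:R) \in unitmx.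
  rewrite unitmxE unitfE det_trig.
    apply/prodf_neq0 => i _; rewrite !mxE eqxx inE.
    by case: (eqVneq (N i i) 0) => [->|Nii]; rewrite ?add0r ?addr0 ?oner_eq0.
  apply/is_trig_mxP => i j lt_ij; rewrite mxE Ntrig // add0r !mxE.
  by rewrite -val_eqE ltn_eqF.

exact: mxrank_add.
Qed.

Lemma mup_char_poly_trig (F : fieldType) (n : nat) (T : 'M[F]_n) (z : F) :
  is_trig_mx T -> mup z (char_poly T) = #|[pred i | T i i == z]|.
Proof.
move=> Ttrig; rewrite char_poly_trig //.
rewrite -(big_map (fun i => T i i) xpredT (fun y => ('X - y%:P))).
rewrite mu_prod_XsubC count_map.
by rewrite -sum1_card -sum1_count; apply: eq_bigl => i.
Qed.

(** Reduces root multiplicities of the pencil to those of [char_poly T]: for invertible [W] and [V]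
    the other factor is a nonzero constant. *)
Lemma pencil_poly_factor (C : numClosedFieldType) (n : nat) (W T V : 'M[C]_n) :
  pencil_poly (W *m V) (W *m T *m V) = (\det W * \det V)%:P * char_poly T.
Proof.
rewrite /pencil_poly /char_poly /char_poly_mx.
have -> : 'X *: map_mx polyC (W *m V) - map_mx polyC (W *m T *m V)
  = map_mx polyC W *m ('X%:M - map_mx polyC T) *m map_mx polyC V.
  by rewrite !map_mxM mulmxBr mulmxBl mul_mx_scalar -scalemxAl.
by rewrite !det_mulmx !det_map_mx polyCM mulrAC.
Qed.

Lemma mup_pencil (C : numClosedFieldType) (n : nat) (W T V : 'M[C]_n) (z : C) :
  W \in unitmx -> V \in unitmx -> is_trig_mx T ->
  mup z (pencil_poly (W *m V) (W *m T *m V)) = #|[pred i | T i i == z]|.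
Proof.
rewrite !unitmxE !unitfE => W0 V0 Ttrig.
by rewrite pencil_poly_factor mupMr ?mup_char_poly_trig // rootC mulf_neq0.
Qed.

Lemma rank_pencil (F : fieldType) (n : nat) (W T V : 'M[F]_n) (z : F) :
  W \in unitmx -> V \in unitmx ->
  \rank (z *: (W *m V) - W *m T *m V) = \rank (z%:M - T).
Proof.
move=> Wu Vu; have -> : z *: (W *m V) - W *m T *m V = W *m (z%:M - T) *m V.
  by rewrite mulmxBr mulmxBl mul_mx_scalar -scalemxAl.
rewrite mxrankMfree ?row_free_unit // -mxrank_tr trmx_mul mxrankMfree.
  by rewrite mxrank_tr.
by rewrite row_free_unit unitmx_tr.
Qed.

(** * Contractions give stable pencils *)

Lemma Schur_trig (C : numClosedFieldType) (n : nat) (M : 'M[C]_n) :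
  exists P T : 'M[C]_n, [/\ P \is unitarymx, is_trig_mx T & P *m M = T *m P].
Proof.
case: n M => [|n] M.
  exists 1%:M, M; split; last by rewrite mul1mx mulmx1.
    by apply/unitarymxP; rewrite trmx1 map_mx1 mulmx1.
  by apply/is_trig_mxP; case.
have [P Pu PT] := Schur M isT; exists P, (conjmx P M); split=> //.
by rewrite conjumx ?unitarymx_unit // mulmxKV ?unitarymx_unit.
Qed.

Lemma unitary_trCK (C : numClosedFieldType) (n : nat) (P : 'M[C]_n) :
  P \is unitarymx -> P ^t* *m P = 1%:M.
Proof.
by move=> Pu; rewrite -invmx_unitary // mulVmx // unitarymx_unit.
Qed.

(** The constant [r] bounds the square of the operator norm, and all complex vectors are tested,
    whereas [spec_norm_le1] tests real ones. *)
Definition contractive (C : numClosedFieldType) (r : C) (n : nat)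
    (K : 'M[C]_n) : Prop :=
  forall x : 'cV[C]_n, vnorm2 (K *m x) <= r * vnorm2 x.

(** Column [i] is the image of a unit vector, so its squared moduli sum to at most 1; a unimodular
    diagonal entry uses up the whole sum. *)
Lemma contractive1_trig_col (C : numClosedFieldType) (n : nat) (T : 'M[C]_n)
    (i : 'I_n) : contractive 1 T ->
  `|T i i| <= 1 /\ (`|T i i| = 1 -> forall j, j != i -> T j i = 0).
Proof.
move=> /(_ (delta_mx i 0)); rewrite mul1r.
have -> : vnorm2 (delta_mx i 0 : 'cV[C]_n) = 1.
  rewrite /vnorm2 (bigD1 i) //= big1 ?addr0 => [|j ji].
    by rewrite mxE !eqxx normr1 expr1n.
  by rewrite mxE (negPf ji) normr0 expr0n.
rewrite -colE /vnorm2 (bigD1 i) //= mxE => le1.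
have ge0 : 0 <= \sum_(j < n | j != i) `|col i T j 0| ^+ 2.
  by apply: sumr_ge0 => j _; rewrite exprn_ge0.
split; first by rewrite -(@expr_le1 _ 2) // (le_trans _ le1) // lerDl.
move=> Tii j ji; have {le1} : \sum_(j < n | j != i) `|col i T j 0| ^+ 2 == 0.
  by rewrite eq_le ge0 andbT -(lerD2l 1) addr0; rewrite Tii expr1n in le1.
rewrite psumr_eq0 => [/allP /(_ j (mem_index_enum j))|k _]; last first.
  exact: exprn_ge0.
by rewrite ji mxE /= sqrf_eq0 normr_eq0 => /eqP.
Qed.

Lemma contractive1_stable (C : numClosedFieldType) (n : nat)
    (E A S K : 'M[C]_n) : E \in unitmx -> S \in unitmx -> contractive 1 K ->
  A = invmx S *m K *m S *m E -> stable_pencil E A.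
Proof.
move=> Eu Su Kc eA z.
have [P [T [Pu Ttrig PK]]] := Schur_trig K.
have PPu : P \in unitmx by apply: unitarymx_unit.
(* [T] equals [P K P^*] with [P] unitary, so it inherits the bound of [K]. *)
have Tc : contractive 1 T.
  move=> x; have -> : T *m x = P *m (K *m (P ^t* *m x)).
    by rewrite !mulmxA PK -(mulmxA T) (unitarymxP Pu) mulmx1.
  rewrite vnorm2_isometry ?unitary_trCK // (le_trans (Kc _)) //.
  rewrite vnorm2_isometry // map_trmx trmxK -map_mx_comp map_mx_id ?(unitarymxP Pu) //.
  exact: conjCK.
(* With these factors [z E - A] becomes [W (z - T) V], so the pencil is governed by the triangular
   [T]. *)
pose W := invmx S *m invmx P; pose V := P *m S *m E.
have Wu : W \in unitmx by rewrite unitmx_mul !unitmx_inv Su.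
have Vu : V \in unitmx by rewrite !unitmx_mul PPu Su.
have eE : E = W *m V.
  by rewrite /W /V !mulmxA mulmxKV // mulVmx // mul1mx.
have {}eA : A = W *m T *m V.
  by rewrite eA /W /V !mulmxA -(mulmxA _ T P) -PK !mulmxA mulmxKV.
clearbody W V.
rewrite /finite_eig /semisimple_eig eE eA mup_pencil // rank_pencil //.
have -> : z *: (W *m V) - W *m T *m V = W *m (z%:M - T) *m V.
  by rewrite mulmxBr mulmxBl mul_mx_scalar -scalemxAl.
have ztrig : is_trig_mx (z%:M - T).
  apply/is_trig_mxP => i j ij; rewrite !mxE (is_trig_mxP Ttrig) //.
  by rewrite -val_eqE ltn_eqF // subr0.
rewrite !det_mulmx => /eqP; rewrite !mulf_eq0.
move: Wu Vu; rewrite !unitmxE !unitfE => /negPf -> /negPf ->.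
rewrite orbF /= det_trig // => /prodf_eq0 [i _]; rewrite !mxE eqxx mulr1n subr_eq0.
move=> /eqP zE; rewrite zE; have [le1 _] := contractive1_trig_col i Tc.
split=> // eq1; rewrite -zE in eq1 *; set P1 := [pred j | _].
(* Upper bound: the columns of [z - T] indexed by [P1] vanish, so it annihilates a diagonal matrix
   of rank [#|P1|]. Lower bound: [trig_rank_ge]. *)
suff rankE : (\rank (z%:M - T)%R + #|P1| = n)%N.
  by rewrite -(addKn (\rank (z%:M - T)) #|P1|) rankE.
apply/eqP; rewrite eqn_leq; apply/andP; split.
  rewrite -(rank_diag_mx_bool C P1); apply: mulmx0_rank_max.
  apply/matrixP => j k; rewrite mul_mx_diag !mxE inE.
  have [Tkk|] := eqVneq (T k k) z; last by rewrite mulr0.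
  rewrite mulr1; have [->|jk] := eqVneq j k; first by rewrite mulr1n Tkk subrr.
  have [_ ->//] := contractive1_trig_col k Tc; first by rewrite subr0.
  by rewrite Tkk.
apply: leq_trans (trig_rank_ge ztrig) _; rewrite leq_add2l; apply/eq_leq.
by apply: eq_card => j; rewrite !inE !mxE eqxx mulr1n subr_eq0 eq_sym.
Qed.

(** * From stable pencils to stable matrices *)

Lemma trig_mulmx (R : pzRingType) (n : nat) (X Y : 'M[R]_n) :
  is_trig_mx X -> is_trig_mx Y ->
  is_trig_mx (X *m Y) /\ forall i, (X *m Y) i i = X i i * Y i i.
Proof.
move=> /is_trig_mxP Xt /is_trig_mxP Yt; split.
  apply/is_trig_mxP => i j ij; rewrite mxE big1 // => k _.
  have [ik|ki] := ltnP i k; first by rewrite Xt ?mul0r.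
  by rewrite Yt ?mulr0 // (leq_ltn_trans ki).
move=> i; rewrite mxE (bigD1 i) //= big1 ?addr0 // => k.
rewrite -val_eqE neq_ltn => /orP[ki|ik]; first by rewrite Yt ?mulr0.
by rewrite Xt ?mul0r.
Qed.

(** The range of [X^2] lies in that of [X], so equal rank makes the two ranges coincide. Since
    [submx] compares row spaces, the argument runs on transposes. *)
Lemma mulmx_sqr_factor (F : fieldType) (n : nat) (X : 'M[F]_n) :
  (\rank X <= \rank (X *m X))%N -> exists Y, X = X *m X *m Y.
Proof.
rewrite -mxrank_tr -(mxrank_tr (X *m X)) trmx_mul => leX.
have /submxP[D XD] : (X^T <= X^T *m X^T)%MS.
  by rewrite -(geq_leqif (mxrank_leqif_sup (submxMl X^T X^T))).
by exists D^T; rewrite -[LHS]trmxK XD !trmx_mul !trmxK.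
Qed.

(* Semisimplicity of [z] is encoded as [N = N^2 Y] for [N = z - M], which says
   that [N] and [N^2] have the same range; unlike the count of multiplicities,
   this identity passes to block decompositions at once. *)
Definition stable_mx (C : numClosedFieldType) (n : nat) (M : 'M[C]_n) : Prop :=
  forall z, \det (z%:M - M) = 0 -> `|z| <= 1 /\
    (`|z| = 1 -> exists Y, z%:M - M = (z%:M - M) *m (z%:M - M) *m Y).

Lemma sub_scalar_similar (F : fieldType) (n : nat) (G M M' : 'M[F]_n) (z : F) :
  G \in unitmx -> G *m M = M' *m G ->
  z%:M - M' = G *m (z%:M - M) *m invmx G.
Proof.
by move=> Gu GM; rewrite mulmxBr GM scalar_mxC -mulmxBl mulmxK.
Qed.

Lemma det_sub_scalar_similar (F : fieldType) (n : nat) (G M M' : 'M[F]_n)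
    (z : F) : G \in unitmx -> G *m M = M' *m G ->
  \det (z%:M - M') = \det (z%:M - M).
Proof.
move=> Gu GM; rewrite (sub_scalar_similar z Gu GM) !det_mulmx mulrAC.
by rewrite -det_mulmx mulmxV // det1 mul1r.
Qed.

Lemma stable_mx_similar (C : numClosedFieldType) (n : nat) (G M M' : 'M[C]_n) :
  G \in unitmx -> G *m M = M' *m G -> stable_mx M -> stable_mx M'.
Proof.
move=> Gu GM Mst z; rewrite (det_sub_scalar_similar z Gu GM) => /Mst[le1 ss].
split=> // /ss[Y NY]; exists (G *m Y *m invmx G).
rewrite !(sub_scalar_similar z Gu GM) {1}NY !mulmxA.
by rewrite !(mulmxKV Gu).
Qed.

Lemma stable_pencil_mx (C : numClosedFieldType) (n : nat) (E A : 'M[C]_n) :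
  E \in unitmx -> stable_pencil E A -> stable_mx (A *m invmx E).
Proof.
move=> Eu EAst; set M := A *m invmx E.
have [P [T [/unitarymx_unit Pu Ttrig PM]]] := Schur_trig M.
pose V := P *m E; have Vu : V \in unitmx by rewrite unitmx_mul Pu.
have PVu : invmx P \in unitmx by rewrite unitmx_inv.
have eE : E = invmx P *m V by rewrite /V mulmxA mulVmx ?mul1mx.
have eA : A = invmx P *m T *m V.
  by rewrite /V !mulmxA -(mulmxA _ T P) -PM mulmxA mulVmx // mul1mx mulmxKV.
suff Tst : stable_mx T.
  apply: (stable_mx_similar PVu _ Tst).
  by rewrite -[LHS](mulmxK Pu) -(mulmxA _ T) -PM mulmxA mulVmx // mul1mx.
move=> z detz; clearbody V.
have /EAst [le1] : finite_eig E A z.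
  rewrite /finite_eig eE eA scalemxAl -mul_mx_scalar -mulmxBl -mulmxBr.
  by rewrite !det_mulmx detz mulr0 mul0r.
move=> ss; split=> // /ss; rewrite /semisimple_eig eE eA mup_pencil //.
rewrite rank_pencil // => mE; apply: mulmx_sqr_factor.
have ztrig : is_trig_mx (z%:M - T).
  apply/is_trig_mxP => i j ij; rewrite !mxE (is_trig_mxP Ttrig) //.
  by rewrite -val_eqE ltn_eqF // subr0.
have [sqtrig sqE] := trig_mulmx ztrig ztrig.
(* Semisimplicity turns the left side into [n]. The squared triangular matrix has the same zero
   diagonal places, so [trig_rank_ge] applied to it gives the bound. *)
rewrite -(leq_add2r #|[pred i | T i i == z]|) {1}mE subnKC ?rank_leq_row //.
apply: leq_trans (trig_rank_ge sqtrig) _; rewrite leq_add2l; apply/eq_leq.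
apply: eq_card => i; rewrite !inE sqE !mxE eqxx mulr1n mulf_eq0 orbb.
by rewrite subr_eq0 eq_sym.
Qed.

(** * Contractive similarity by splitting off eigenvalues *)

(** A left eigenvector [v] is completed to a basis by [row_ebase v], whose first row is proportional
    to [v]; in that basis the first row of [M] becomes [(t, 0)]. *)
Lemma eigen_block (F : fieldType) (n : nat) (M : 'M[F]_(1 + n)) (t : F) :
  \det (t%:M - M) = 0 -> exists (G : 'M_(1 + n)) (c : 'cV_n) (T : 'M_n),
    G \in unitmx /\ G *m M = block_mx t%:M 0 c T *m G.
Proof.
move=> /eqP/det0P[v v0]; rewrite mulmxBr mul_mx_scalar => /eqP.
rewrite subr_eq0 => /eqP vM; pose G : 'M_(1 + n) := row_ebase v.
have Gu : G \in unitmx by apply: row_ebase_unit.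
pose u : 'rV[F]_(1 + n) := row_mx 1%:M 0.
have [a a0 vE] : exists2 a, a != 0 & v = a *: (u *m G).
  exists (col_ebase v 0 0).
    by have := col_ebase_unit v; rewrite unitmxE det_mx11 unitfE.
  rewrite -[LHS]mulmx_ebase rank_rV v0 -mulmxA {1}[col_ebase v]mx11_scalar.
  by rewrite mul_scalar_mx pid_mx_row.
have uG : u *m G *m M = t *: (u *m G).
  by apply: (scalerI a0); rewrite [LHS]scalemxAl scalerA mulrC -scalerA -vE vM.
pose M' : 'M_(1 + n) := G *m M *m invmx G.
have uM' : u *m M' = t *: u.
  by rewrite /M' !mulmxA uG -scalemxAl mulmxK.
exists G, (dlsubmx M'), (drsubmx M'); split=> //.
move: uM'; rewrite -{1}(submxK M') mul_row_block !mul1mx !mul0mx !addr0.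
rewrite scale_row_mx scaler0 scalemx1 => /eq_row_mx[<- <-].
by rewrite submxK /M' mulmxKV.
Qed.

Lemma sub_scalar_lblock (R : pzRingType) (n : nat) (t z : R) (c : 'cV[R]_n)
    (T : 'M[R]_n) :
  z%:M - block_mx t%:M 0 c T = block_mx (z - t)%:M 0 (- c) (z%:M - T).
Proof.
by rewrite (scalar_mx_block 1 n) opp_block_mx add_block_mx oppr0 addr0 add0r
  raddfB.
Qed.

Lemma det_sub_scalar_lblock (F : fieldType) (n : nat) (t z : F) (c : 'cV[F]_n)
    (T : 'M[F]_n) :
  \det (z%:M - block_mx t%:M 0 c T) = (z - t) * \det (z%:M - T).
Proof.
by rewrite sub_scalar_lblock det_lblock det_scalar1.
Qed.

(** Weighted Young inequality, multiplied through by [d] to avoid division; after the triangle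
    inequality the gap is the square of [|a| - d |b|]. *)
Lemma normD_sqr_le (C : numClosedFieldType) (d a b : C) : 0 <= d ->
  d * `|a + b| ^+ 2 <= (1 + d) * `|a| ^+ 2 + d * (1 + d) * `|b| ^+ 2.
Proof.
move=> d0; apply: (@le_trans _ _ (d * (`|a| + `|b|) ^+ 2)).
  by rewrite ler_wpM2l // ler_sqr ?nnegrE ?addr_ge0 // ler_normD.
rewrite -subr_ge0.
have -> : (1 + d) * `|a| ^+ 2 + d * (1 + d) * `|b| ^+ 2
  - d * (`|a| + `|b|) ^+ 2 = (`|a| - d * `|b|) ^+ 2 by ring.
by rewrite -realEsqr rpredB ?rpredM ?normr_real ?ger0_real.
Qed.

Lemma vnorm2D_le (C : numClosedFieldType) (n : nat) (d : C) (x y : 'cV[C]_n) :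
  0 <= d ->
  d * vnorm2 (x + y) <= (1 + d) * vnorm2 x + d * (1 + d) * vnorm2 y.
Proof.
move=> d0; rewrite !mulr_sumr -big_split /=; apply: ler_sum => i _.
by rewrite mxE normD_sqr_le.
Qed.

Lemma mul_lblock_col (F : fieldType) (n : nat) (t : F) (c : 'cV[F]_n)
    (T : 'M[F]_n) (x : 'cV[F]_1) (y : 'cV[F]_n) :
  block_mx t%:M 0 c T *m col_mx x y = col_mx (t *: x) (x 0 0 *: c + T *m y).
Proof.
rewrite mul_block_col mul0mx addr0 mul_scalar_mx; congr (col_mx _ (_ + _)).
by rewrite {1}[x]mx11_scalar mul_mx_scalar.
Qed.

(* Shrinking the coupling column [c] by a small [e] leaves room for the
   diagonal blocks, both of which contract strictly. *)
Lemma lblock_contractive (C : numClosedFieldType) (n : nat) (t r : C)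
    (c : 'cV[C]_n) (K : 'M[C]_n) : `|t| < 1 -> 0 <= r < 1 -> contractive r K ->
  exists e s, [/\ e != 0, 0 <= s < 1 &
    contractive s (block_mx t%:M 0 (e *: c) K)].
Proof.
move=> t1 /andP[r0 r1] Kr; pose a := 1 - r; pose b := 1 - `|t| ^+ 2.
have a0 : 0 < a by rewrite subr_gt0.
have b0 : 0 < b by rewrite subr_gt0 expr_lt1.
have a1 : a <= 1 by rewrite gerBl.
have b1 : b <= 1 by rewrite gerBl exprn_ge0.
(* Half the product of the two gaps: [2 d] is then at most each of [a], [b] and 1, and the new bound
   will be [s = 1 - d]. *)
pose d := a * b / 2.
have d0 : 0 < d by rewrite divr_gt0 ?mulr_gt0.
have da : 2 * d <= a by rewrite mulrC divfK ?pnatr_eq0 // ler_piMr // ltW.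
have db : 2 * d <= b by rewrite mulrC divfK ?pnatr_eq0 // ler_piMl // ltW.
have d1 : 2 * d <= 1 by apply: le_trans a1.
pose g := vnorm2 c; have g0 : 0 <= g := vnorm2_ge0 c.
(* Chosen so that [2 e^2 g <= d^2], because [2 g <= (1 + g)^2]. *)
pose e := d / (1 + g).
have g1 : 0 < 1 + g by rewrite ltr_wpDr.
have e0 : 0 < e by rewrite divr_gt0.
exists e, (1 - d); split.
- by rewrite gt_eqF.
- rewrite gtrBl d0 andbT subr_ge0 (le_trans _ d1) //.
  by rewrite mulr_natl mulr2n lerDl ltW.
move=> x; rewrite -(vsubmxK x) mul_lblock_col !vnorm2_col_mx.
set p := usubmx x; set q := dsubmx x.
have d_le1 : d <= 1 by rewrite (le_trans _ d1) // mulr_natl mulr2n lerDl ltW.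
have edg : e * (1 + g) = d by rewrite /e divfK // gt_eqF.
clearbody e d.
have e2g : 2 * (e ^+ 2 * g) <= d ^+ 2.
  rewrite -edg exprMn -subr_ge0.
  have -> : e ^+ 2 * (1 + g) ^+ 2 - 2 * (e ^+ 2 * g) = e ^+ 2 * (1 + g ^+ 2).
    by ring.
  by rewrite mulr_ge0 ?addr_ge0 ?exprn_ge0 // ltW.
have le_q : d * (1 + d) * vnorm2 (K *m q) <= d * (1 - d) * vnorm2 q.
  rewrite -!mulrA ler_pM2l //; apply: (@le_trans _ _ ((1 + d) * (r * vnorm2 q))).
    by rewrite ler_wpM2l ?Kr // addr_ge0 // ltW.
  rewrite mulrA ler_wpM2r ?vnorm2_ge0 // -subr_ge0.
  have -> : 1 - d - (1 + d) * r = (a - 2 * d) + d * a by rewrite /a; ring.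
  by rewrite addr_ge0 ?subr_ge0 // mulr_ge0 // ltW.
have le_p : d * `|t| ^+ 2 + (1 + d) * (e ^+ 2 * g) <= d * (1 - d).
  rewrite -subr_ge0.
  have -> : d * (1 - d) - (d * `|t| ^+ 2 + (1 + d) * (e ^+ 2 * g))
    = d * (b - 2 * d) + (d ^+ 2 - 2 * (e ^+ 2 * g)) + (1 - d) * (e ^+ 2 * g).
    by rewrite /b; ring.
  apply: addr_ge0; first apply: addr_ge0; rewrite ?subr_ge0 //.
    by rewrite mulr_ge0 ?subr_ge0 // ltW.
  by rewrite !mulr_ge0 ?subr_ge0 ?exprn_ge0 // ltW.
have pE : vnorm2 p = `|p 0 0| ^+ 2 by rewrite /vnorm2 big_ord1.
(* After multiplication by [d], the Young inequality separates the coupling term from [K q]; [le_p]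
   and [le_q] then bound the parts in [p] and [q]. *)
rewrite -(ler_pM2l d0) mulrDr.
apply: (le_trans (lerD (lexx _) (vnorm2D_le _ _ (ltW d0)))).
have -> : d * ((1 - d) * (vnorm2 p + vnorm2 q))
  = d * (1 - d) * vnorm2 p + d * (1 - d) * vnorm2 q by ring.
rewrite addrA lerD // !vnorm2Z -/g (gtr0_norm e0) pE.
rewrite [leLHS](_ : _ = (d * `|t| ^+ 2 + (1 + d) * (e ^+ 2 * g)) * `|p 0 0| ^+ 2).
  by rewrite ler_wpM2r ?exprn_ge0.
by ring.
Qed.

Lemma lblock_intertwine (R : comPzRingType) (n : nat) (t : R) (c : 'cV[R]_n)
    (G T K : 'M[R]_n) : G *m T = K *m G ->
  block_mx (1%:M : 'M_1) 0 0 G *m block_mx t%:M 0 c T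
  = block_mx t%:M 0 (G *m c) K *m block_mx 1%:M 0 0 G.
Proof.
move=> GT; rewrite !mulmx_block !(mul0mx, mulmx0, mul1mx, mulmx1).
by rewrite !(addr0, add0r) GT.
Qed.

Lemma diag_block_contractive (C : numClosedFieldType) (n : nat) (t r : C)
    (K : 'M[C]_n) : `|t| <= 1 -> r <= 1 -> contractive r K ->
  contractive 1 (block_mx (t%:M : 'M_1) 0 0 K).
Proof.
move=> t1 r1 Kr x.
rewrite -(vsubmxK x) mul_lblock_col scaler0 add0r !vnorm2_col_mx mul1r.
rewrite lerD ?(le_trans (Kr _)) ?ler_piMl ?vnorm2_ge0 // vnorm2Z.
by rewrite ler_piMl ?vnorm2_ge0 // exprn_ile1.
Qed.

(** Indexing the eigenvalues by a finite type makes the search for one on the unit circle a finite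
    one. *)
Lemma det_sub_scalar_roots (C : numClosedFieldType) (n : nat) (M : 'M[C]_n) :
  exists e : 'I_n -> C, forall z, \det (z%:M - M) = \prod_i (z - e i).
Proof.
have [P [T [/unitarymx_unit Pu /is_trig_mxP Ttrig PM]]] := Schur_trig M.
exists (fun i => T i i) => z; rewrite -(det_sub_scalar_similar z Pu PM).
rewrite det_trig; first by apply: eq_bigr => i _; rewrite !mxE eqxx.
apply/is_trig_mxP => i j ij; rewrite !mxE Ttrig //.
by rewrite -val_eqE ltn_eqF // subr0.
Qed.

(** The lower left block of [N = N^2 Y] at [z = t] exhibits [c] in the range of [T - t], which is
    what a shear needs to remove the coupling. *)
Lemma lblock_stable_coupling (C : numClosedFieldType) (n : nat) (t : C)
    (c : 'cV[C]_n) (T : 'M[C]_n) :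
  stable_mx (block_mx t%:M 0 c T) -> `|t| = 1 ->
  exists w, c = (T - t%:M) *m w.
Proof.
move=> /(_ t); rewrite det_sub_scalar_lblock subrr mul0r => /(_ erefl)[_].
move=> /[apply] -[Y]; rewrite sub_scalar_lblock subrr raddf0 -(submxK Y).
rewrite !mulmx_block !mul0mx !addr0 !mulmx0 !add0r.
move=> /eq_block_mx[_ _ cE _].
exists (- c *m ulsubmx Y + (t%:M - T) *m dlsubmx Y).
by apply: oppr_inj; rewrite {1}cE -mulNmx opprB [in RHS]mulmxDr !mulmxA.
Qed.

Lemma diag_block_stable (C : numClosedFieldType) (n : nat) (t : C)
    (T : 'M[C]_n) : stable_mx (block_mx (t%:M : 'M_1) 0 0 T) -> stable_mx T.
Proof.
move=> Bst z detz; have [|le1 ss] := Bst z.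
  by rewrite det_sub_scalar_lblock detz mulr0.
split=> // /ss[Y]; rewrite sub_scalar_lblock oppr0 -(submxK Y).
rewrite !mulmx_block !(mul0mx, mulmx0, addr0, add0r) => /eq_block_mx[_ _ _].
by exists (drsubmx Y).
Qed.

(* An eigenvalue on the unit circle is taken first: its coupling to the rest can
   be removed exactly, whereas [lblock_contractive] needs strict inequalities. *)
Lemma stable_mx_contractive (C : numClosedFieldType) (n : nat) (M : 'M[C]_n) :
  stable_mx M -> exists (G K : 'M[C]_n) (r : C),
    [/\ G \in unitmx, G *m M = K *m G, 0 <= r <= 1, contractive r K &
      (forall z, \det (z%:M - M) = 0 -> `|z| < 1) -> r < 1].
Proof.
elim: n M => [|n IHn] M Mst.
  exists 1%:M, M, 0; rewrite unitmx1 mul1mx mulmx1; split=> //.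
  - by rewrite lexx ler01.
  - by move=> x; rewrite mul0r /vnorm2 big_ord0.
change ('M[C]_(1 + n)) in (type of M).
(* Take [t] on the unit circle if some eigenvalue lies there; otherwise any eigenvalue serves, all
   of them being strictly inside. *)
have [t tM tmax] : exists2 t, \det (t%:M - M) = 0 &
    `|t| < 1 -> forall z, \det (z%:M - M) = 0 -> `|z| < 1.
  have [e eE] := det_sub_scalar_roots M.
  case: (pickP [pred i | `|e i| == 1]) => [i /eqP ei|no1].
    exists (e i); last by rewrite ei ltxx.
    by rewrite eE (bigD1 i) //= subrr mul0r.
  exists (e 0) => [|_ z detz]; first by rewrite eE (bigD1 0) //= subrr mul0r.
  rewrite lt_neqAle (Mst _ detz).1 andbT.
  move: detz => /eqP; rewrite eE => /prodf_eq0[i _]; rewrite subr_eq0 => /eqP->.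
  by have /= -> := no1 i.
have [le_t _] := Mst _ tM.
have [G0 [c [T [G0u GM]]]] := eigen_block tM.
have {Mst} Bst := stable_mx_similar G0u GM Mst.
have detM z : \det (z%:M - M) = (z - t) * \det (z%:M - T).
  by rewrite -(det_sub_scalar_similar z G0u GM) det_sub_scalar_lblock.
have [t1|t_neq1] := eqVneq `|t| 1.
  have [w cE] := lblock_stable_coupling Bst t1.
  (* The shear by [w] cancels the coupling, since [c + w t = T w]. *)
  pose G1 : 'M_(1 + n) := block_mx 1%:M 0 w 1%:M.
  have G1u : G1 \in unitmx by rewrite unitmxE det_lblock !det1 mulr1 unitr1.
  have GB : G1 *m block_mx t%:M 0 c T = block_mx (t%:M : 'M_1) 0 0 T *m G1.
    rewrite !mulmx_block !mul0mx !mulmx0 !mul1mx !mulmx1 !addr0 !add0r cE.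
    by rewrite mul_mx_scalar mulmxBl mul_scalar_mx addrC subrK.
  have Tst := diag_block_stable (stable_mx_similar G1u GB Bst).
  have [G' [K' [r [G'u GT /andP[r0 r1] Kr _]]]] := IHn T Tst.
  (* Here [r = 1] is admissible: [t] itself refutes the premise of the strictness clause. *)
  exists (block_mx 1%:M 0 0 G' *m G1 *m G0), (block_mx (t%:M : 'M_1) 0 0 K'), 1; split.
  - by rewrite !unitmx_mul G0u G1u (@block_diag_mx_unit _ 1 n) unitmx1 G'u.
  - rewrite -!mulmxA GM (mulmxA G1) GB !mulmxA. congr (_ *m _ *m _).
    by rewrite (lblock_intertwine t 0 GT) mulmx0.
  - by rewrite ler01 lexx.
  - by apply: diag_block_contractive Kr; rewrite ?t1.
  - by move=> /(_ t tM); rewrite t1.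
have t_lt1 : `|t| < 1 by rewrite lt_neqAle t_neq1.
have Mlt := tmax t_lt1.
have Tlt z : \det (z%:M - T) = 0 -> `|z| < 1.
  by move=> detz; apply: Mlt; rewrite detM detz mulr0.
have [|G' [K' [r [G'u GT /andP[r0 _] Kr /(_ Tlt) r1]]]] := IHn T.
  by move=> z /Tlt z1; split; [apply: ltW | move=> zE; rewrite zE ltxx in z1].
have [|e [s [e0 /andP[s0 s1] Ks]]] := lblock_contractive (G' *m c) t_lt1 _ Kr.
  by rewrite r0.
(* Scaling [G'] by [e] scales the coupling column by [e] and leaves [K'] unchanged. *)
exists (block_mx 1%:M 0 0 (e *: G') *m G0),
  (block_mx t%:M 0 (e *: (G' *m c)) K'), s; split=> //.
- rewrite unitmx_mul G0u (@block_diag_mx_unit _ 1 n) unitmx1 /=.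
  by rewrite unitmxZ ?unitfE // G'u.
- rewrite -mulmxA GM !mulmxA; congr (_ *m _).
  rewrite scalemxAl; apply: lblock_intertwine.
  by rewrite -scalemxAl GT scalemxAr.
- by rewrite s0 ltW.
Qed.

(** * Real matrices and orthogonal completion *)

Lemma realmxP (C : numClosedFieldType) (m n : nat) (M : 'M[C]_(m, n)) :
  is_realmx M <-> M ^ Num.conj = M.
Proof.
split=> [rM|eM i j]; first by apply/matrixP => i j; rewrite mxE; apply/CrealP.
by apply/CrealP; rewrite -{2}eM mxE.
Qed.

Lemma realmx_mul (C : numClosedFieldType) (m n p : nat) (A : 'M[C]_(m, n))
    (B : 'M[C]_(n, p)) : is_realmx A -> is_realmx B -> is_realmx (A *m B).
Proof. by move=> /realmxP rA /realmxP rB; apply/realmxP; rewrite map_mxM rA rB. Qed.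

Lemma realmx_tr (C : numClosedFieldType) (m n : nat) (A : 'M[C]_(m, n)) :
  is_realmx A -> is_realmx A^T.
Proof. by move=> rA i j; rewrite mxE. Qed.

Lemma realmx_inv (C : numClosedFieldType) (n : nat) (A : 'M[C]_n) :
  is_realmx A -> is_realmx (invmx A).
Proof. by move=> /realmxP rA; apply/realmxP; rewrite map_invmx rA. Qed.

Lemma realmx_scale (C : numClosedFieldType) (m n : nat) (a : C)
    (A : 'M[C]_(m, n)) : a \is Num.real -> is_realmx A -> is_realmx (a *: A).
Proof. by move=> ra rA i j; rewrite mxE realM. Qed.

Lemma realmxB (C : numClosedFieldType) (m n : nat) (A B : 'M[C]_(m, n)) :
  is_realmx A -> is_realmx B -> is_realmx (A - B).
Proof. by move=> rA rB i j; rewrite !mxE realB. Qed.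

Lemma realmx_scalar (C : numClosedFieldType) (n : nat) (a : C) :
  a \is Num.real -> is_realmx (a%:M : 'M_n).
Proof. by move=> ra i j; rewrite !mxE; case: eqP => _; rewrite ?mulr1n ?mulr0n. Qed.

Lemma realmx0 (C : numClosedFieldType) (m n : nat) :
  is_realmx (0 : 'M[C]_(m, n)).
Proof. by move=> i j; rewrite !mxE. Qed.

Lemma realmx_block (C : numClosedFieldType) (m1 m2 n1 n2 : nat)
    (A : 'M[C]_(m1, n1)) (B : 'M[C]_(m1, n2)) (D : 'M[C]_(m2, n1))
    (F : 'M[C]_(m2, n2)) :
  is_realmx (block_mx A B D F) <->
  [/\ is_realmx A, is_realmx B, is_realmx D & is_realmx F].
Proof.
split=> [|[rA rB rD rF]].
  by move=> /realmxP; rewrite map_block_mx => /eq_block_mx[rA rB rD rF]; split;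
    apply/realmxP.
by apply/realmxP; rewrite map_block_mx; congr block_mx; apply/realmxP.
Qed.

Lemma vnorm2_real (C : numClosedFieldType) (n : nat) (x : 'cV[C]_n) :
  is_realmx x -> x^T *m x = (vnorm2 x)%:M.
Proof.
move=> /realmxP rx; rewrite [LHS]mx11_scalar vnorm2E; congr (_ 0 0)%:M.
by rewrite -map_trmx rx.
Qed.

Lemma vnorm2_orthogonal (C : numClosedFieldType) (m n : nat) (P : 'M[C]_(m, n))
    (x : 'cV[C]_n) : is_realmx P -> P^T *m P = 1%:M ->
  vnorm2 (P *m x) = vnorm2 x.
Proof.
by move=> /realmxP rP PP; apply: vnorm2_isometry; rewrite -map_trmx rP.
Qed.

(* The Householder reflection along [v - e]. *)
Lemma orthogonal_extension (C : numClosedFieldType) (n : nat)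
    (v : 'cV[C]_(1 + n)) : is_realmx v -> v^T *m v = 1%:M ->
  exists H : 'M[C]_(1 + n),
    [/\ is_realmx H, H^T *m H = 1%:M & H *m col_mx 1%:M 0 = v].
Proof.
move=> rv vv; set e := col_mx 1%:M 0.
have re : is_realmx e.
  by apply/realmxP; rewrite map_col_mx map_mx1 map_mx0.
have ee : e^T *m e = 1%:M.
  by rewrite tr_col_mx mul_row_col trmx1 trmx0 mul1mx mul0mx addr0.
have [->|ve] := eqVneq v e.
  exists 1%:M; split; rewrite ?trmx1 ?mul1mx //.
  exact: realmx_scalar.
pose w := v - e; have rw : is_realmx w by apply: realmxB.
pose a := (v^T *m e) 0 0; have vEe : v^T *m e = a%:M by apply: mx11_scalar.
have eEv : e^T *m v = a%:M by rewrite -[LHS]trmxK trmx_mul trmxK vEe tr_scalar_mx.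
pose q := vnorm2 w; have q0 : 0 < q by rewrite vnorm2_gt0 // subr_eq0.
have wT : w^T = v^T - e^T by apply: raddfB.
have ww : w^T *m w = q%:M by apply: vnorm2_real.
have qE : q = 2 * (1 - a).
  move: ww; rewrite wT mulmxBl !mulmxBr vv vEe eEv ee.
  rewrite -!raddfB /= => /matrixP/(_ 0 0); rewrite !mxE !mulr1n => <-.
  by ring.
(* With [s = 2 / q] this yields [H e = e + w = v]. *)
have we : w^T *m e = (- (q / 2))%:M.
  rewrite wT mulmxBl vEe ee -raddfB /= qE; congr (_%:M).
  by rewrite mulrAC divff ?pnatr_eq0 // mul1r opprB.
pose s := 2 / q; pose H := 1%:M - s *: (w *m w^T).
have HT : H^T = H by rewrite /H raddfB /= trmx1 linearZ /= trmx_mul trmxK.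
have sq : s * q = 2 by rewrite divfK // gt_eqF.
have rs : s \is Num.real by rewrite ger0_real // divr_ge0 // ltW.
clearbody s.
exists H; split.
- apply: realmxB; first exact: realmx_scalar.
  by apply: realmx_scale => //; apply: realmx_mul => //; apply: realmx_tr.
- have WW : w *m w^T *m (w *m w^T) = q *: (w *m w^T).
    by rewrite mulmxA -(mulmxA w) ww mul_mx_scalar -scalemxAl.
  rewrite HT /H mulmxBl mul1mx mulmxBr mulmx1 -scalemxAl -scalemxAr WW.
  rewrite (scalerA s q) sq scalerA mulrC -scalerA scaler_nat mulr2n.
  by rewrite opprB addrK subrK.
- rewrite /H mulmxBl mul1mx -scalemxAl -mulmxA we mul_mx_scalar scalerA.
  rewrite mulrN mulrA sq divff ?pnatr_eq0 // scaleN1r opprK.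
  by rewrite /w addrC subrK.
Qed.

(** * Real singular value and polar decompositions *)

Lemma vnorm2_mul_real (C : numClosedFieldType) (m n : nat) (K : 'M[C]_(m, n))
    (x : 'cV[C]_n) :
  is_realmx K -> vnorm2 (K *m x) = (x ^t* *m (K^T *m K *m x)) 0 0.
Proof.
by move=> /realmxP rK; rewrite vnorm2E trmx_mul map_mxM -(map_trmx _ K) rK !mulmxA.
Qed.

Lemma real_singular_vector (C : numClosedFieldType) (n : nat) (K : 'M[C]_n) :
  is_realmx K -> K != 0 -> exists (v : 'cV_n) (s : C),
    [/\ is_realmx v, v^T *m v = 1%:M, 0 < s
      & K^T *m K *m v = s ^+ 2 *: v].
Proof.
move=> rK K0; set H := K^T *m K.
have rH : is_realmx H by apply: realmx_mul => //; apply: realmx_tr.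
have HT : H^T = H by rewrite /H trmx_mul trmxK.
have rHE : H ^ Num.conj = H by apply/realmxP.
have Hnormal : H \is normalmx by apply/normalmxP; rewrite HT rHE.
(* Were all eigenvalues of [K^T K] zero, the spectral theorem would give [K^T K = 0], hence
   [K x = 0] for every [x]. *)
have [i di0] : exists i, spectral_diag H 0 i != 0.
  apply/existsP; apply: contraNT K0; rewrite negb_exists => /forallP d0.
  have {}d0 : spectral_diag H = 0.
    by apply/rowP => i; rewrite mxE; apply/eqP; rewrite -[_ == _]negbK d0.
  have /orthomx_spectralP HE := Hnormal.
  have H0 : H = 0 by rewrite HE d0 linear0 mulmx0 mul0mx.
  have Kx0 x : K *m x = 0 :> 'cV_n.
    apply/eqP/negPn/negP => /vnorm2_gt0.
    by rewrite vnorm2_mul_real // -/H H0 mul0mx mulmx0 mxE ltxx.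
  apply/eqP/matrixP => j k; have /colP/(_ j) := Kx0 (delta_mx k 0).
  by rewrite -colE !mxE.
(* Rows of [spectralmx H] are left eigenvectors; as [H] is symmetric, their transposes are right
   eigenvectors. *)
pose d := spectral_diag H 0 i; pose x := (row i (spectralmx H))^T.
have x0 : x != 0.
  rewrite trmx_eq0; apply/eqP => r0.
  have := row_mul i (spectralmx H) (invmx (spectralmx H)).
  rewrite r0 mul0mx mulmxV ?spectral_unit // row1 => /rowP/(_ i)/eqP.
  by rewrite !mxE !eqxx oner_eq0.
have Hx : H *m x = d *: x.
  have /orthomx_spectralP HE := Hnormal.
  rewrite -{1}HT -trmx_mul -linearZ /= -row_mul; congr (_^T).
  rewrite {2}HE !mulmxA mulmxV ?spectral_unit // mul1mx.
  by rewrite row_mul row_diag_mx -scalemxAl -rowE.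
have d_gt0 : 0 < d.
  rewrite lt0r di0 -(pmulr_lge0 _ (vnorm2_gt0 x0)) vnorm2E.
  have -> : d * (x ^t* *m x) 0 0 = vnorm2 (K *m x).
    by rewrite vnorm2_mul_real // -/H Hx -scalemxAr [RHS]mxE.
  exact: vnorm2_ge0.
have rd : d \is Num.real by rewrite ger0_real // ltW.
(* Since [H] and [d] are real, [x] plus its conjugate satisfies the same equation; if that sum is
   zero, [x] is purely imaginary and ['i *: x] is real. *)
have [y [ry y0 Hy]] : exists y : 'cV_n, [/\ is_realmx y, y != 0 & H *m y = d *: y].
  have Hxc : H *m map_mx Num.conj x = d *: map_mx Num.conj x.
    by rewrite -{1}rHE -map_mxM Hx map_mxZ /= (CrealP rd).
  have [xc|xc] := eqVneq (x + map_mx Num.conj x) 0.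
    exists ('i *: x); split.
    - apply/realmxP; rewrite map_mxZ /= conjCi scaleNr -scalerN; congr (_ *: _).
      by apply/eqP; rewrite -subr_eq0 -opprD oppr_eq0 addrC xc.
    - by rewrite scaler_eq0 negb_or neq0Ci.
    - by rewrite -scalemxAr Hx !scalerA mulrC.
  exists (x + map_mx Num.conj x); split=> //; last by rewrite mulmxDr Hx Hxc scalerDr.
  apply/realmxP; rewrite map_mxD -map_mx_comp addrC; congr (_ + _).
  by apply: map_mx_id => c; apply: conjCK.
pose c := (sqrtC (vnorm2 y))^-1.
have c_gt0 : 0 < c by rewrite invr_gt0 sqrtC_gt0 vnorm2_gt0.
have rc : c \is Num.real by rewrite ger0_real // ltW.
exists (c *: y), (sqrtC d); split.
- exact: realmx_scale.
- rewrite [(c *: y)^T]linearZ /= -scalemxAl -scalemxAr scalerA vnorm2_real // scale_scalar_mx.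
  by rewrite -expr2 exprVn sqrtCK mulVf // gt_eqF ?vnorm2_gt0.
- by rewrite sqrtC_gt0.
- by rewrite -scalemxAr Hy sqrtCK scalerA mulrC -scalerA.
Qed.

(** Deflation: a singular pair [u], [v] is completed to orthogonal [P], [Q]; then [P^T K Q] splits
    off the singular value [s], and induction treats the remaining block. *)
Lemma real_svd (C : numClosedFieldType) (n : nat) (K : 'M[C]_n) :
  is_realmx K -> exists (U V : 'M[C]_n) (d : 'rV[C]_n),
    [/\ is_realmx U /\ is_realmx V, U^T *m U = 1%:M, V^T *m V = 1%:M,
        forall i, 0 <= d 0 i & K = U *m diag_mx d *m V].
Proof.
elim: n K => [|n IHn] K rK.
  exists 1%:M, 1%:M, 0; split; rewrite ?trmx1 ?mul1mx //.
  - by split; apply: realmx_scalar.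
  - by case.
  - by apply/matrixP => -[].
change ('M[C]_(1 + n)) in (type of K).
have [->|K0] := eqVneq K 0.
  exists 1%:M, 1%:M, 0; split; rewrite ?trmx1 ?mul1mx //.
  - by split; apply: realmx_scalar.
  - by move=> i; rewrite mxE.
  - by rewrite raddf0 mul0mx.
have [v [s [rv vv s0 Kv]]] := real_singular_vector rK K0.
have s_neq0 : s != 0 by rewrite gt_eqF.
have rs : s \is Num.real by rewrite ger0_real // ltW.
pose u := s^-1 *: (K *m v).
have ru : is_realmx u.
  by apply: realmx_scale; [rewrite realV | apply: realmx_mul].
have Ku : K^T *m u = s *: v.
  rewrite -scalemxAr mulmxA Kv scalerA expr2 mulrA mulVf // mul1r.
  by [].
have uu : u^T *m u = 1%:M.
  by rewrite {1}/u [(_ *: _)^T]linearZ /= -scalemxAl trmx_mul -mulmxA Ku -scalemxAr vv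
    scalerA mulVf // scale1r.
have [P [rP PP Pe]] := orthogonal_extension ru uu.
have [Q [rQ QQ Qe]] := orthogonal_extension rv vv.
have PPt : P *m P^T = 1%:M by apply: mulmx1C.
have QQt : Q *m Q^T = 1%:M by apply: mulmx1C.
pose L : 'M_(1 + n) := P^T *m K *m Q.
have Le : L *m col_mx 1%:M 0 = s *: col_mx 1%:M 0.
  have Kvu : K *m v = s *: u by rewrite scalerA mulfV // scale1r.
  by rewrite /L -!mulmxA Qe Kvu -scalemxAr -Pe mulmxA PP mul1mx.
have LTe : L^T *m col_mx 1%:M 0 = s *: col_mx 1%:M 0.
  by rewrite /L !trmx_mul trmxK -!mulmxA Pe Ku -scalemxAr -Qe mulmxA QQ mul1mx.
have LE : L = block_mx s%:M 0 0 (drsubmx L).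
  move: Le LTe; rewrite -{1 2}(submxK L) tr_block_mx !mul_block_col.
  rewrite !mulmx1 !mulmx0 !addr0 scale_col_mx scaler0 scalemx1.
  move=> /eq_col_mx[ul dl] /eq_col_mx[_ ur].
  by rewrite -[LHS]submxK ul dl -[ursubmx L]trmxK ur trmx0.
have rL : is_realmx L.
  by apply: realmx_mul => //; apply: realmx_mul => //; apply: realmx_tr.
have /IHn[U [V [d [[rU rV] UU VV d0 drE]]]] : is_realmx (drsubmx L).
  by move: rL; rewrite {1}LE => /realmx_block[].
have r1_block (X : 'M[C]_n) : is_realmx X -> is_realmx (block_mx (1%:M : 'M_1) 0 0 X).
  move=> rX; apply/realmx_block; split=> //; try exact: realmx0.
  exact: realmx_scalar.
have o1_block (X : 'M[C]_n) : X^T *m X = 1%:M ->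
    (block_mx (1%:M : 'M_1) 0 0 X)^T *m block_mx (1%:M : 'M_1) 0 0 X = 1%:M.
  move=> XX; rewrite tr_block_mx mulmx_block !trmx0 trmx1.
  rewrite !(mul0mx, mulmx0, addr0, add0r) mulmx1 XX.
  by rewrite -(scalar_mx_block 1 n).
have svd_block : block_mx (s%:M : 'M_1) 0 0 (U *m diag_mx d *m V) =
    block_mx 1%:M 0 0 U *m diag_mx (row_mx s%:M d) *m block_mx 1%:M 0 0 V.
  rewrite diag_mx_row !mulmx_block !(mul0mx, mulmx0, addr0, add0r) !mulmx1 mul1mx.
  by congr block_mx; apply/matrixP => i j; rewrite !ord1 !mxE.
exists (P *m block_mx 1%:M 0 0 U), (block_mx 1%:M 0 0 V *m Q^T), (row_mx s%:M d).
split.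
- split; apply: realmx_mul => //; try exact: r1_block.
  exact: realmx_tr.
- by rewrite trmx_mul -mulmxA (mulmxA P^T) PP mul1mx o1_block.
- rewrite trmx_mul trmxK -mulmxA (mulmxA (_^T)) o1_block // mul1mx.
  exact: QQt.
- move=> i; rewrite mxE; case: splitP => j _; last exact: d0.
  by rewrite ord1 mxE eqxx mulr1n ltW.
- have -> : K = P *m L *m Q^T.
    by rewrite /L !mulmxA PPt mul1mx -mulmxA QQt mulmx1.
  by rewrite LE drE svd_block !mulmxA.
Qed.

(** Regroup [U D V] as [(U V) (V^T D V)]. *)
Lemma real_polar (C : numClosedFieldType) (n : nat) (K : 'M[C]_n) :
  is_realmx K -> exists U B : 'M[C]_n,
    [/\ is_realmx U /\ is_realmx B, U^T *m U = 1%:M, sym_psd B & K = U *m B].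
Proof.
move=> /real_svd[U [V [d [[rU rV] UU VV d0 ->]]]].
have VVt : V *m V^T = 1%:M by apply: mulmx1C.
have rd : is_realmx (diag_mx d).
  move=> i j; rewrite mxE; case: eqP => _; rewrite ?mulr0n // mulr1n.
  by rewrite ger0_real.
have rVt : is_realmx V^T by apply: realmx_tr.
exists (U *m V), (V^T *m diag_mx d *m V); split.
- by split; do ?apply: realmx_mul.
- by rewrite trmx_mul -mulmxA (mulmxA U^T) UU mul1mx VV.
- split=> [|x rx]; first by rewrite !trmx_mul trmxK tr_diag_mx mulmxA.
  have rVx : is_realmx (V *m x) by apply: realmx_mul.
  have -> : x^T *m (V^T *m diag_mx d *m V) *m x
    = (V *m x)^T *m (diag_mx d *m (V *m x)) by rewrite trmx_mul !mulmxA.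
  rewrite mxE sumr_ge0 // => i _; rewrite mul_diag_mx [X in X * _]mxE mxE mulrCA.
  by rewrite mulr_ge0 // -expr2 -realEsqr rVx.
- by rewrite !mulmxA -(mulmxA U V) VVt mulmx1.
Qed.

(** * Real Cholesky factorisation *)

Lemma real_cholesky (C : numClosedFieldType) (n : nat) (P : 'M[C]_n) :
  is_realmx P -> P^T = P ->
  (forall x : 'cV_n, is_realmx x -> x != 0 -> 0 < (x^T *m P *m x) 0 0) ->
  exists S : 'M[C]_n, [/\ is_realmx S, S \in unitmx & P = S^T *m S].
Proof.
elim: n P => [|n IHn] => [P _ _ _|].
  exists 1%:M; split; [exact: realmx_scalar | exact: unitmx1 |].
  by apply/matrixP => -[].
rewrite -[n.+1]/(1 + n)%N => P rP PT Ppos.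
pose a := ulsubmx P 0 0; pose c := a^-1 *: dlsubmx P; pose D := drsubmx P.
have ulE : ulsubmx P = a%:M by apply: mx11_scalar.
have r1 : is_realmx (1%:M : 'M[C]_1) by apply: realmx_scalar.
have a0 : 0 < a.
  have := Ppos (col_mx 1%:M 0); rewrite -{1}(submxK P) tr_col_mx mul_row_block.
  rewrite mul_row_col trmx1 trmx0 !(mul0mx, mulmx0, addr0) mul1mx mulmx1.
  apply.
    by apply/realmxP; rewrite map_col_mx map_mx1 map_mx0.
  by apply/eqP => /eqP; rewrite col_mx_eq0 (negPf (matrix_nonzero1 _ _)).
have a_neq0 : a != 0 by rewrite gt_eqF.
have ra : a \is Num.real by rewrite ger0_real // ltW.
have dlE : dlsubmx P = a *: c by rewrite scalerA mulfV // scale1r.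
have [urE DT] : ursubmx P = a *: c^T /\ D^T = D.
  move: PT; rewrite -{1 2}(submxK P) tr_block_mx => /eq_block_mx[_ <- _ DT].
  by split=> //; rewrite dlE linearZ.
have PE : P = block_mx a%:M (a *: c^T) (a *: c) D.
  by rewrite -ulE -urE -dlE submxK.
have [rc rD] : is_realmx c /\ is_realmx D.
  move: rP; rewrite -{1}(submxK P) => /realmx_block[_ _ rdl rD]; split=> //.
  by apply: realmx_scale; rewrite ?realV.
have rcT : is_realmx c^T by apply: realmx_tr.
clearbody c D.
have [|||S [rS Su SE]] := IHn (D - a *: (c *m c^T)).
- by apply: realmxB => //; apply: realmx_scale => //; apply: realmx_mul.
- by rewrite linearB /= DT linearZ /= trmx_mul trmxK.
(* The Schur complement is positive definite: its form at [y] is that of [P] at [(- c^T y, y)],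
   where the first block row contributes nothing. *)
- move=> y ry y0; have := Ppos (col_mx (- (c^T *m y)) y); rewrite PE tr_col_mx.
  have yT : (- (c^T *m y))^T = - (y^T *m c).
    by rewrite [LHS]linearN /= trmx_mul trmxK.
  rewrite mul_row_block mul_row_col yT.
  have -> : - (y^T *m c) *m a%:M + y^T *m (a *: c) = 0.
    by rewrite mul_mx_scalar -scalemxAr scalerN addNr.
  rewrite mul0mx add0r.
  have -> : - (y^T *m c) *m (a *: c^T) + y^T *m D = y^T *m (D - a *: (c *m c^T)).
    by rewrite mulmxBr -!scalemxAr mulNmx scalerN mulmxA addrC.
  apply.
    apply/realmxP; rewrite map_col_mx map_mxN.
    by rewrite (proj1 (realmxP _) (realmx_mul rcT ry)) (proj1 (realmxP _) ry).
  by rewrite col_mx_eq0 negb_and y0 orbT.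
pose s := sqrtC a.
have s0 : 0 < s by rewrite sqrtC_gt0.
have rs : s \is Num.real by rewrite ger0_real // ltW.
exists (block_mx (s%:M : 'M_1) (s *: c^T) 0 S); split.
- apply/realmx_block; split=> //; [exact: realmx_scalar| |exact: realmx0].
  exact: realmx_scale.
- rewrite unitmxE det_ublock det_scalar1 unitrM -unitmxE Su unitfE andbT.
  by rewrite gt_eqF.
- rewrite PE tr_block_mx mulmx_block !trmx0 !(mul0mx, mulmx0, addr0) tr_scalar_mx.
  rewrite -SE [(s *: _)^T]linearZ /= trmxK !mul_scalar_mx !mul_mx_scalar !scalerA.
  rewrite -scalemxAl -scalemxAr scalerA -expr2 sqrtCK scale_scalar_mx -expr2 sqrtCK.
  by rewrite addrC subrK.
Qed.

(** * Passage between real and complex contractions *)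

Lemma real_contraction_of_complex (C : numClosedFieldType) (n : nat)
    (M G K : 'M[C]_n) : is_realmx M -> G \in unitmx -> G *m M = K *m G ->
  contractive 1 K -> exists S L : 'M[C]_n,
    [/\ is_realmx S, is_realmx L, S \in unitmx, S *m M = L *m S
      & spec_norm_le1 L].
Proof.
move=> rM Gu GM Kc; pose Q := G ^t* *m G; pose P := Q + map_mx Num.conj Q.
have QT : Q^T = map_mx Num.conj Q.
  rewrite trmx_mul map_mxM -!map_trmx trmxK -map_mx_comp.
  by rewrite (map_mx_id (@conjCK C)).
have quadP (x : 'cV_n) : is_realmx x ->
    (x^T *m P *m x) 0 0 = 2 * vnorm2 (G *m x).
  move=> /realmxP rx; have xQx : (x^T *m Q *m x) 0 0 = vnorm2 (G *m x).
    by rewrite vnorm2E trmx_mul map_mxM -(map_trmx _ x) rx !mulmxA.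
  have -> : x^T *m P *m x = x^T *m Q *m x + map_mx Num.conj (x^T *m Q *m x).
    by rewrite !(map_mxM _ (_ *m _)) (map_mxM _ x^T) -(map_trmx _ x) rx mulmxDr mulmxDl.
  rewrite [LHS]mxE [X in _ + X]mxE xQx.
  by rewrite geC0_conj ?vnorm2_ge0 // mulr_natl mulr2n.
have [|||S [rS Su SE]] := @real_cholesky _ _ P.
- apply/realmxP; rewrite map_mxD -map_mx_comp (map_mx_id (@conjCK C)).
  by rewrite addrC.
- by rewrite linearD /= QT map_trmx QT -map_mx_comp (map_mx_id (@conjCK C)) addrC.
- move=> x rx x0; rewrite quadP // mulr_gt0 // vnorm2_gt0 //.
  by apply: contra x0 => /eqP Gx; rewrite -(mulKmx Gu x) Gx mulmx0.
(* On real vectors [S] and [G] thus define the same norm up to a constant factor, so the contraction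
   bound transfers from [G] to [S]. *)
have normS (x : 'cV_n) : is_realmx x -> vnorm2 (S *m x) = 2 * vnorm2 (G *m x).
  move=> rx; rewrite vnorm2_mul_real // -SE -quadP // mulmxA.
  by rewrite -map_trmx (proj1 (realmxP _) rx).
have rSi := realmx_inv rS.
exists S, (S *m M *m invmx S); split=> //.
- by apply: realmx_mul => //; apply: realmx_mul.
- by rewrite mulmxKV.
- move=> y ry; pose x := invmx S *m y.
  have rx : is_realmx x by apply: realmx_mul.
  have -> : y = S *m x by rewrite mulKVmx.
  rewrite mulmxA mulmxKV // -mulmxA !normS //; last exact: realmx_mul.
  by rewrite ler_pM2l // mulmxA GM -mulmxA (le_trans (Kc _)) // mul1r.
Qed.

(** The two vectors on the right are [2 Re x] and [- 2 Im x], both real. *)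
Lemma vnorm2_real_imaginary (C : numClosedFieldType) (n : nat) (x : 'cV[C]_n) :
  4 * vnorm2 x = vnorm2 (x + map_mx Num.conj x)
    + vnorm2 ('i *: (x - map_mx Num.conj x)).
Proof.
rewrite mulr_sumr -big_split /=; apply: eq_bigr => i _.
rewrite !mxE normrM normCi mul1r !normCK rmorphD rmorphB /= conjCK; ring.
Qed.

(** A real [K] commutes with conjugation, so the bounds for the real and imaginary parts add up. *)
Lemma spec_norm_le1_contractive (C : numClosedFieldType) (n : nat)
    (K : 'M[C]_n) : is_realmx K -> spec_norm_le1 K -> contractive 1 K.
Proof.
move=> rK Kle x; have Kx : map_mx Num.conj (K *m x) = K *m map_mx Num.conj x.
  by rewrite map_mxM (proj1 (realmxP _) rK).
have conjxK : map_mx Num.conj (map_mx Num.conj x) = x.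
  by rewrite -map_mx_comp (map_mx_id (@conjCK C)).
rewrite mul1r -(@ler_pM2l _ 4) // !vnorm2_real_imaginary Kx.
rewrite -mulmxDr -mulmxBr scalemxAr; apply: lerD; apply: Kle; apply/realmxP.
  by rewrite map_mxD conjxK addrC.
by rewrite map_mxZ map_mxB conjxK /= conjCi scaleNr -scalerN opprB.
Qed.

(** * Index of a pair with nonsingular [E], and the equivalence *)

(** The Weierstrass form is taken with [W = E], [T = 1], [q = n] and [N = 0], so the nilpotency
    clause is vacuous. *)
Lemma index_le_unit (C : numClosedFieldType) (n : nat) (E A : 'M[C]_n) (k : nat) :
  is_realmx E -> is_realmx A -> E \in unitmx -> index_le E A k.
Proof.
move=> rE rA Eu; exists E, 1%:M, n, (invmx E *m A), 0.
split; last by rewrite ltnn.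
rewrite /weierstrass_form /copid_mx pid_mx_1 subrr !mulmx1 !mul1mx !mul0mx !addr0.
rewrite mulmx1 mulKVmx //; split; last split; last split=> //.
- split=> //; [exact: realmx_scalar| |exact: realmx0].
  by apply: realmx_mul => //; apply: realmx_inv.
- by rewrite unitmx1.
- by split=> //; exists 1%N; rewrite expr1.
Qed.

Theorem theorem4 (C : numClosedFieldType) (n : nat) (E A : 'M[C]_n) :
  is_realmx E -> is_realmx A -> E \in unitmx ->
  (admissible E A <->
   exists S U B : 'M[C]_n,
     [/\ is_realmx S, is_realmx U & is_realmx B] /\
     [/\ S \in unitmx, U^T *m U = 1%:M, sym_psd B, spec_norm_le1 B
       & A = invmx S *m U *m B *m S *m E]).
Proof.
move=> rE rA Eu; split.
  case=> _ _ /(stable_pencil_mx Eu) /stable_mx_contractive.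
  move=> [G [K [r [Gu GM /andP[_ r1] Kr _]]]].
  have [|//|S [L [rS rL Su SM Lle]]] := real_contraction_of_complex _ Gu GM.
  - by apply: realmx_mul => //; apply: realmx_inv.
  - by move=> x; rewrite (le_trans (Kr x)) // ler_wpM2r ?vnorm2_ge0.
  have [U [B [[rU rB] UU Bpsd LE]]] := real_polar rL.
  exists S, U, B; split=> //; split=> //.
    move=> x rx; rewrite -(vnorm2_orthogonal (B *m x) rU UU) mulmxA -LE.
    exact: Lle.
  by rewrite -(mulmxA (invmx S)) -LE -(mulmxA _ L) -SM mulKmx // mulmxKV.
move=> [S [U [B [[rS rU rB] [Su UU _ Ble AE]]]]].
have UBc : contractive 1 (U *m B).
  apply: spec_norm_le1_contractive; first exact: realmx_mul.
  by move=> x rx; rewrite -mulmxA vnorm2_orthogonal // Ble.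
have st : stable_pencil E A.
  by apply: (contractive1_stable Eu Su UBc); rewrite AE !mulmxA.
split=> //; last exact: index_le_unit.
(* Stability confines the eigenvalues to the closed unit disk, so 2 is not one and witnesses
   regularity. *)
exists 2; apply/eqP => /st[]; rewrite normr_nat.
by rewrite (ler_nat _ 2 1).
Qed.
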